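(* For every integer $m\ge 2$ and every integer $n\ge 3$, the set $\mathcal{C}^n(4^m,\,2^{m-1}(2^m-1),\,2^{m-1}(2^{m-1}-1))$ contains at least two inequivalent group cubes that are not difference cubes (i.e. that are not equivalent to any difference cube).
   Context: A symmetric $(v,k,\lambda)$ design is a collection of $v$ $k$-subsets (blocks) of a $v$-set such that every pair of distinct points lies in exactly $\lambda$ blocks; its incidence matrix is $a_{ij}=[p_i\in B_j]$ ($[P]$ is $1$ if $P$ holds, else $0$). An $n$-cube of order $v$ is a function $C:\{1,\ldots,v\}^n\to\{0,1\}$; a slice is the $v\times v$ matrix obtained by varying two distinct coordinate positions $x$ (rows) and $y$ (columns) and fixing the other coordinates. $\mathcal{C}^n(v,k,\lambda)$ is the set of $n$-cubes of order $v$ all of whose slices are incidence matrices of symmetric $(v,k,\lambda)$ designs. A $(v,k,\lambda)$ difference set in a group $G$ of order $v$ is a $k$-subset $D$ such that every non-identity element equals $d_1^{-1}d_2$ ($d_1,d_2\in D$) in exactly $\lambda$ ways. A difference cube is a cube $C(i_1,\ldots,i_n)=[g_{i_1}\cdots g_{i_n}\in D]$ for some group $G=\{g_1,\ldots,g_v\}$ and difference set $D$ in $G$. A group cube is a cube $C(i_1,\ldots,i_n)=[g_{i_2}\cdots g_{i_n}\in B_{i_1}]$, where $G=\{g_1,\ldots,g_v\}$ is a group and $\{B_1,\ldots,B_v\}$ is a symmetric $(v,k,\lambda)$ design on the point set $G$ all of whose blocks are $(v,k,\lambda)$ difference sets in $G$. Equivalence (paratopy): the wreath product $S_v\wr S_n$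 acts on $n$-cubes, generated by isotopies $C^\alpha(i_1,\ldots,i_n)=C(\alpha_1^{-1}(i_1),\ldots,\alpha_n^{-1}(i_n))$ for $(\alpha_1,\ldots,\alpha_n)\in(S_v)^n$ and conjugations $C^\gamma(i_1,\ldots,i_n)=C(i_{\gamma^{-1}(1)},\ldots,i_{\gamma^{-1}(n)})$ for $\gamma\in S_n$; two cubes are equivalent if they lie in the same orbit of this action. *)

(* Defs.v *)
From mathcomp Require Import all_boot all_fingroup.

Set Implicit Arguments.
Unset Strict Implicit.
Unset Printing Implicit Defensive.

Local Open Scope group_scope.

(* The blocks are a family indexed by 'I_v, so that #|[set j | ...]| counts
   blocks with their multiplicity. *)
Definition symmetric_design (v k lambda : nat) (P : finType)
    (B : 'I_v -> {set P}) : Prop :=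
  [/\ #|P| = v,
      forall j, #|B j| = k
    & forall p q : P, p != q ->
        #|[set j | (p \in B j) && (q \in B j)]| = lambda].

Definition incidence_matrix_of_design (v k lambda : nat)
    (M : 'I_v -> 'I_v -> bool) : Prop :=
  exists (P : finType) (p : 'I_v -> P) (B : 'I_v -> {set P}),
    [/\ bijective p, symmetric_design k lambda B
      & forall i j, M i j = (p i \in B j)].

(* Coordinates and coordinate positions are numbered from 0. *)
Definition cube (n v : nat) : finType := {ffun {ffun 'I_n -> 'I_v} -> bool}.

(* The values of c at x and y are irrelevant. *)
Definition slice (n v : nat) (C : cube n v) (x y : 'I_n)
    (c : {ffun 'I_n -> 'I_v}) (i j : 'I_v) : bool :=
  C [ffun z => if z == x then i else if z == y then j else c z].

Definition design_cube (n v k lambda : nat) (C : cube n v) : Prop :=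
  forall (x y : 'I_n) (c : {ffun 'I_n -> 'I_v}), x != y ->
    incidence_matrix_of_design k lambda (slice C x y c).

Definition difference_set (v k lambda : nat) (G : finGroupType)
    (D : {set G}) : Prop :=
  [/\ #|G| = v,
      #|D| = k
    & forall g : G, g != 1 ->
        #|[set d : G * G | [&& d.1 \in D, d.2 \in D & d.1^-1 * d.2 == g]]|
          = lambda].

Definition difference_cube (n v k lambda : nat) (C : cube n v) : Prop :=
  exists (G : finGroupType) (g : 'I_v -> G) (D : {set G}),
    [/\ bijective g, difference_set v k lambda D
      & forall i : {ffun 'I_n -> 'I_v}, C i = (\prod_(t < n) g (i t) \in D)].

(* z is the first coordinate position. *)
Definition group_cube (n v k lambda : nat) (C : cube n v) : Prop :=
  exists (G : finGroupType) (g : 'I_v -> G) (B : 'I_v -> {set G}) (z : 'I_n),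
    [/\ bijective g,
        symmetric_design k lambda B,
        forall j, difference_set v k lambda (B j),
        z = 0 :> nat
      & forall i : {ffun 'I_n -> 'I_v},
          C i = (\prod_(t < n | 0 < t) g (i t) \in B (i z))].

Definition isotopy (n v : nat) (alpha : {ffun 'I_n -> 'S_v})
    (C : cube n v) : cube n v :=
  [ffun i : {ffun 'I_n -> 'I_v} => C [ffun t => (alpha t)^-1 (i t)]].

Definition conjugation (n v : nat) (gamma : 'S_n) (C : cube n v) : cube n v :=
  [ffun i : {ffun 'I_n -> 'I_v} => C [ffun t => i (gamma^-1 t)]].

Lemma isotopy_inj (n v : nat) (alpha : {ffun 'I_n -> 'S_v}) :
  injective (@isotopy n v alpha).
Proof.
move=> C1 C2 /ffunP eqC; apply/ffunP=> i.
have := eqC [ffun t => alpha t (i t)]; rewrite !ffunE.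
suff -> : [ffun t => (alpha t)^-1 ([ffun t => alpha t (i t)] t)] = i by [].
by apply/ffunP=> t; rewrite !ffunE permK.
Qed.

Lemma conjugation_inj (n v : nat) (gamma : 'S_n) :
  injective (@conjugation n v gamma).
Proof.
move=> C1 C2 /ffunP eqC; apply/ffunP=> i.
have := eqC [ffun t => i (gamma t)]; rewrite !ffunE.
suff -> : [ffun t => [ffun t => i (gamma t)] (gamma^-1 t)] = i by [].
by apply/ffunP=> t; rewrite !ffunE permKV.
Qed.

(* The group of permutations of the set of cubes induced by the wreath product
   of 'S_v by 'S_n. *)
Definition paratopy_group (n v : nat) : {group {perm cube n v}} :=
  <<[set perm (@isotopy_inj n v alpha) | alpha : {ffun 'I_n -> 'S_v}]
    :|: [set perm (@conjugation_inj n v gamma) | gamma : 'S_n]>>%G.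

Definition equivalent_cubes (n v : nat) (C1 C2 : cube n v) : Prop :=
  C2 \in orbit 'P (paratopy_group n v) C1.

(* Main.v *)
Require Import Defs.
From HB Require Import structures.
From mathcomp Require Import all_boot all_fingroup all_algebra zify.

Import GRing.Theory.

(** Let [f_i], [i \in G], be bent functions on an elementary abelian 2-group [G]
of order [4 ^ m] such that the signs of [f_i(x)] form a regular Hadamard matrix.
The supports of the [f_i] are difference sets and form a symmetric design, and
[C(i_1, ..., i_n) = f_{i_1}(i_2 ... i_n)] is a group cube.  The set of ranks over
the two-element field of the slices of a cube is invariant under equivalence,
and all slices of a difference cube have the same rank.

Write [i = (b, a, (c, d, u))] and [x = (x_1, x_2, (x_3, x_4, w))], and put
[f_i(x) = (x_1 + b)(x_2 + a) + (x_3 + c + a x_2 p)(x_4 + d + a x_2 p') + q(w u)]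
with [q] bent and [(p, p') = t(c, d)], where [(c, d) + t(c, d)] is a permutation
of the pairs.  For [t = 0] the [f_i] are the translates of [f_1].  The row space
grows by [x_2 x_4] for [t(c, d) = (d, 0)], and by both [x_2 x_4] and [x_2 x_3]
for [t(c, d) = (d, c + d)], so the ranks [r_0 < r_1 < r_2] of the three designs
increase strictly.  Slices with [i_1 = 1] constant have rank [r_0], those with
[i_1] varying have the rank of the design, and for [t(c, d) = (d, 0)] all slices
have rank at most [r_1], since translating an [f_i] stays in the row space. *)

(** * Regular Hadamard matrices *)

HB.instance Definition _ := Finite_isGroup.Build bool addbA addFb addbb.

Definition sgn (b : bool) : int := ((-1) ^+ b)%R.

(** Entries are exponents of -1, [r] is both the common line sum and the square root of the order,
    and [*+ (i == j)] is a Kronecker delta. Rows and columns enter symmetrically, so transposition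
    preserves the notion. *)
Definition regular_hadamard {S T : finType} (r : nat) (M : S -> T -> bool) :=
  [/\ #|S| = r ^ 2 /\ #|T| = r ^ 2,
      forall i, (\sum_x sgn (M i x) = r%:R)%R,
      forall x, (\sum_i sgn (M i x) = r%:R)%R,
      forall i j, (\sum_x sgn (M i x (+) M j x) = r%:R ^+ 2 *+ (i == j))%R
    & forall x y, (\sum_i sgn (M i x (+) M i y) = r%:R ^+ 2 *+ (x == y))%R].

Lemma sgn_addb (a b : bool) : sgn (a (+) b) = (sgn a * sgn b)%R.
Proof. by case: a; case: b. Qed.

Lemma regular_hadamard_tr {S T : finType} (r : nat) (M : S -> T -> bool) :
  regular_hadamard r M -> regular_hadamard r (fun x i => M i x).
Proof. by case=> -[cS cT] sr sc pr pc; split. Qed.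

Lemma eq_regular_hadamard {S T : finType} (r : nat) (M N : S -> T -> bool) :
  (forall i x, M i x = N i x) -> regular_hadamard r M -> regular_hadamard r N.
Proof.
move=> eqMN [cS sr sc pr pc]; split=> // [i|x|i j|x y].
- by rewrite -(sr i); apply: eq_bigr => x _; rewrite eqMN.
- by rewrite -(sc x); apply: eq_bigr => i _; rewrite eqMN.
- by rewrite -(pr i j); apply: eq_bigr => x _; rewrite !eqMN.
- by rewrite -(pc x y); apply: eq_bigr => i _; rewrite !eqMN.
Qed.

Lemma sum_quadrant {T : finType} (F : bool * bool * T -> int) :
  (\sum_p F p = \sum_z F (true, true, z) + \sum_z F (true, false, z) +
   (\sum_z F (false, true, z) + \sum_z F (false, false, z)))%R.
Proof.
rewrite (eq_bigr (fun p => F (p.1, p.2))%R) => [|[]//].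
rewrite -(pair_bigA _ (fun u z => F (u, z))%R) /=.
rewrite (eq_bigr (fun p => \sum_z F (p.1, p.2, z))%R) => [|[]//].
by rewrite -(pair_bigA _ (fun x y => \sum_z F (x, y, z))%R) /= !big_bool.
Qed.

(* Summing over [x] leaves only the terms with equal [a] (rows) or equal [y]
   (columns), so [s] need only permute [S] for each fixed pair [(a, y)]. *)
Lemma regular_hadamard_step {S T : finType} (r : nat) (M : S -> T -> bool)
    (a0 b0 : bool) (s : bool -> bool -> S -> S) :
  (forall a y, injective (s a y)) -> regular_hadamard r M ->
  regular_hadamard (2 * r) (fun (i : bool * bool * S) (g : bool * bool * T) =>
    ((g.1.1 (+) i.1.1 (+) b0) && (g.1.2 (+) i.1.2 (+) a0))
    (+) M (s i.1.2 g.1.2 i.2) g.2).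
Proof.
move=> injs [[cS cT] sr sc pr pc]; split.
- by rewrite !card_prod !card_bool cS cT expnMn.
- move=> [[b a] j]; rewrite sum_quadrant /=.
  do 4![under eq_bigr do rewrite sgn_addb; rewrite -mulr_sumr sr].
  by rewrite natrM; case: a; case: b; case: a0; case: b0; rewrite /sgn /=; lia.
- move=> [[x y] z]; rewrite sum_quadrant /=.
  have sc' a : (\sum_j sgn (M (s a y j) z) = r%:R)%R.
    by rewrite -(sc z) [RHS](reindex_inj (injs a y)).
  do 4![under eq_bigr do rewrite sgn_addb; rewrite -mulr_sumr sc'].
  by rewrite natrM {sc'}; case: x; case: y; case: a0; case: b0; rewrite /sgn /=; lia.
- move=> [[b a] j] [[b' a'] j']; rewrite sum_quadrant /=.
  do 4![under eq_bigr do rewrite addbACA sgn_addb; rewrite -mulr_sumr].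
  case: (eqVneq a a') => [->|ne_a]; last first.
    have -> : ((b, a, j) == (b', a', j')) = false.
      by rewrite !xpair_eqE (negPf ne_a) andbF.
    by move: ne_a; case: a; case: a' => //; case: b; case: b'; case: a0; case: b0;
      rewrite /sgn /=; lia.
  rewrite !pr !(inj_eq (injs _ _)) !xpair_eqE eqxx andbT.
  by case: (j == j'); case: a'; case: b; case: b'; case: a0; case: b0;
    rewrite /sgn ?mulr0n ?mulr1n /=; lia.
- move=> [[x y] z] [[x' y'] z']; rewrite sum_quadrant /=.
  do 4![under eq_bigr do rewrite addbACA sgn_addb; rewrite -mulr_sumr].
  (* The cancellation now comes from the first row coordinate [b], whose coefficient in the exponent
     is [y (+) y']. *)
  case: (eqVneq y y') => [->|ne_y]; last first.
    have -> : ((x, y, z) == (x', y', z')) = false.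
      by rewrite !xpair_eqE (negPf ne_y) andbF.
    by move: ne_y; case: y; case: y' => //; case: x; case: x'; case: a0; case: b0;
      rewrite /sgn /=; lia.
  have pc' a : (\sum_j sgn (M (s a y' j) z (+) M (s a y' j) z')
                = r%:R ^+ 2 *+ (z == z'))%R.
    by rewrite -(pc z) [RHS](reindex_inj (injs a y')).
  rewrite !pc' {pc'} !xpair_eqE eqxx andbT.
  by case: (z == z'); case: y'; case: x; case: x'; case: a0; case: b0;
    rewrite /sgn ?mulr0n ?mulr1n /=; lia.
Qed.

(** * Designs and difference sets from regular Hadamard matrices *)

Lemma sum_sgn_card {T : finType} (P : pred T) :
  (\sum_x sgn (P x) = #|T|%:R - 2%:R * #|[set x | P x]|%:R)%R.
Proof.
rewrite cardsE -!sum1_card !natr_sum mulr_sumr [X in (_ - X)%R]big_mkcond -sumrB.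
by apply: eq_bigr => x _; rewrite unfold_in /=; case: (P x).
Qed.

Lemma regular_hadamard_row_card {S T : finType} (r : nat) (M : S -> T -> bool)
    (i : S) :
  regular_hadamard r M -> 2 * #|[set x | M i x]| + r = r ^ 2.
Proof. by case=> -[_ cT] /(_ i); rewrite sum_sgn_card cT => *; lia. Qed.

(** Orthogonality makes the symmetric difference of the two supports half of [T]. Both supports have
    the size found above, which determines their intersection. *)
Lemma regular_hadamard_rowI_card {S T : finType} (r : nat) (M : S -> T -> bool)
    (i j : S) :
  regular_hadamard r M -> i != j ->
  4 * #|[set x | M i x && M j x]| + 2 * r = r ^ 2.
Proof.
move=> hM ne_ij; have [[_ cT] _ _ /(_ i j) + _] := hM.
rewrite (negPf ne_ij) mulr0n sum_sgn_card.
have := regular_hadamard_row_card _ _ i hM.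
have := regular_hadamard_row_card _ _ j hM.
rewrite cT.
have -> : #|[set x | M i x]|
  = #|[set x | M i x && M j x]| + #|[set x | M i x && ~~ M j x]|.
  rewrite -(cardsID [set x | M j x] [set x | M i x]).
  by congr (_ + _); apply: eq_card => x; rewrite !inE // andbC.
have -> : #|[set x | M j x]|
  = #|[set x | M i x && M j x]| + #|[set x | ~~ M i x && M j x]|.
  rewrite -(cardsID [set x | M i x] [set x | M j x]).
  by congr (_ + _); apply: eq_card => x; rewrite !inE // andbC.
have -> : #|[set x | M i x (+) M j x]|
  = #|[set x | M i x && ~~ M j x]| + #|[set x | ~~ M i x && M j x]|.
  rewrite -(cardsID [set x | M i x] [set x | M i x (+) M j x]).
  by congr (_ + _); apply: eq_card => x; rewrite !inE;
    case: (M i x); case: (M j x).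
lia.
Qed.

(** With [r = 2 ^ m], the row counts become the Menon parameters: [k] here, [lambda] in the next
    lemma. *)
Lemma menon_k (m c : nat) : 0 < m -> 2 * c + 2 ^ m = (2 ^ m) ^ 2 ->
  c = 2 ^ (m - 1) * (2 ^ m - 1).
Proof.
case: m => // m _; rewrite subn1 /= expnS; set u := 2 ^ m => e.
have : 0 < u by rewrite expn_gt0.
nia.
Qed.

Lemma menon_lambda (m c : nat) : 0 < m -> 4 * c + 2 * 2 ^ m = (2 ^ m) ^ 2 ->
  c = 2 ^ (m - 1) * (2 ^ (m - 1) - 1).
Proof.
case: m => // m _; rewrite subn1 /= expnS; set u := 2 ^ m => e.
have : 0 < u by rewrite expn_gt0.
nia.
Qed.

Lemma regular_hadamard_design {S T : finType} (v m : nat) (M : S -> T -> bool)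
    (p : 'I_v -> S) (q : 'I_v -> T) :
  0 < m -> regular_hadamard (2 ^ m) M -> bijective p -> bijective q ->
  symmetric_design (2 ^ (m - 1) * (2 ^ m - 1))
    (2 ^ (m - 1) * (2 ^ (m - 1) - 1)) (fun j => [set i | M i (q j)]).
Proof.
move=> m_gt0 hM bij_p bij_q; split.
- by rewrite -(bij_eq_card bij_p) card_ord.
- move=> j; apply: menon_k => //.
  exact: (regular_hadamard_row_card _ _ (q j) (regular_hadamard_tr _ _ hM)).
- move=> i i' ne_i; apply: menon_lambda => //.
  rewrite -(regular_hadamard_rowI_card _ _ _ _ hM ne_i); congr (4 * _ + _).
  rewrite -(on_card_preimset (f := q)) /=; last exact: onW_bij.
  by apply: eq_card => j; rewrite !inE.
Qed.

Lemma regular_hadamard_incidence {S T : finType} (v m : nat)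
    (M : S -> T -> bool) (p : 'I_v -> S) (q : 'I_v -> T)
    (N : 'I_v -> 'I_v -> bool) :
  0 < m -> regular_hadamard (2 ^ m) M -> bijective p -> bijective q ->
  (forall i j, N i j = M (p i) (q j)) ->
  incidence_matrix_of_design (2 ^ (m - 1) * (2 ^ m - 1))
    (2 ^ (m - 1) * (2 ^ (m - 1) - 1)) N.
Proof.
move=> m_gt0 hM bij_p bij_q eN.
exists S, p, (fun j => [set i | M i (q j)]); split=> //.
  exact: (regular_hadamard_design _ _ _ p q).
by move=> i j; rewrite inE eN.
Qed.

(** By commutativity, the pairs with quotient [g] are the pairs [(x, g * x)] with [x] in the
    supports of both row [1] and row [g], so a row intersection counts them. *)
Lemma regular_hadamard_difference_set {G : finGroupType} (v m : nat)
    (f : G -> bool) (p : 'I_v -> G) :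
  0 < m -> commutative (@mulg G) -> bijective p ->
  regular_hadamard (2 ^ m) (fun g h : G => f (g * h)%g) ->
  difference_set v (2 ^ (m - 1) * (2 ^ m - 1))
    (2 ^ (m - 1) * (2 ^ (m - 1) - 1)) [set g | f g].
Proof.
move=> m_gt0 mulC bij_p hM; split.
- by rewrite -(bij_eq_card bij_p) card_ord.
- apply: menon_k => //; rewrite -(regular_hadamard_row_card _ _ 1%g hM).
  by congr (2 * _ + _); apply: eq_card => x; rewrite !inE mul1g.
- move=> g ne_g; apply: menon_lambda => //.
  have ne_g1 : (1 : G)%g != g by rewrite eq_sym.
  rewrite -(regular_hadamard_rowI_card _ _ _ _ hM ne_g1); congr (4 * _ + _).
  rewrite -(card_imset _ (f := fun x : G => (x, g * x)%g)); last by move=> x y [].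
  apply: eq_card => -[x y]; rewrite !inE /=; apply/and3P/imsetP.
    move=> [fx fy /eqP def_g]; have yE : (y = g * x)%g.
      by rewrite mulC -def_g mulKVg.
    by exists x; rewrite ?yE // inE mul1g fx -yE.
  move=> [z]; rewrite inE mul1g => /andP[fz fgz] [-> ->].
  by split=> //; rewrite (mulC g) mulKg.
Qed.

(** * Ranks and row spaces over the two-element field *)

Section BoolRank.
Local Open Scope ring_scope.

(** [bool] is the two-element field, with exclusive or as addition. *)
Definition bool_rank {v : nat} (M : 'I_v -> 'I_v -> bool) : nat :=
  \rank (\matrix_(i, j) M i j : 'M[bool]_v).

Lemma eq_bool_rank {v : nat} (M N : 'I_v -> 'I_v -> bool) :
  (forall i j, M i j = N i j) -> bool_rank M = bool_rank N.
Proof.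
move=> eMN; congr (\rank _); apply/matrixP => i j; rewrite !mxE; exact: eMN.
Qed.

Lemma bool_rank_tr {v : nat} (M : 'I_v -> 'I_v -> bool) :
  bool_rank (fun i j => M j i) = bool_rank M.
Proof.
rewrite /bool_rank -mxrank_tr; congr (\rank _).
by apply/matrixP => i j; rewrite !mxE.
Qed.

Lemma bool_rank_row {v : nat} (M : 'I_v -> 'I_v -> bool) (p : 'I_v -> 'I_v) :
  injective p -> bool_rank (fun i j => M (p i) j) = bool_rank M.
Proof.
move=> inj_p.
have -> : bool_rank M =
    \rank (row_perm (perm inj_p) (\matrix_(i, j) M i j : 'M[bool]_v)).
  by rewrite row_permE eqmxMfull // row_full_unit unitmx_perm.
by congr (\rank _); apply/matrixP => i j; rewrite !mxE permE.
Qed.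

Lemma bool_rank_bij {v : nat} (M : 'I_v -> 'I_v -> bool) (p q : 'I_v -> 'I_v) :
  injective p -> injective q ->
  bool_rank (fun i j => M (p i) (q j)) = bool_rank M.
Proof.
move=> inj_p inj_q; rewrite (bool_rank_row (fun i j => M i (q j))) //.
by rewrite -bool_rank_tr (bool_rank_row (fun j i => M i j)) // bool_rank_tr.
Qed.

Lemma bool_rank_transport {v : nat} {T : finType} (g : 'I_v -> T)
    (M : T -> T -> bool) (p q : 'I_v -> T) :
  bijective g -> injective p -> injective q ->
  bool_rank (fun i j => M (p i) (q j)) = bool_rank (fun i j => M (g i) (g j)).
Proof.
move=> [g' gK g'K] inj_p inj_q.
rewrite -(@bool_rank_bij _ (fun i j => M (g i) (g j)) (g' \o p) (g' \o q)).
- by apply: eq_bool_rank => i j /=; rewrite !g'K.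
- exact: inj_comp (can_inj g'K) inj_p.
- exact: inj_comp (can_inj g'K) inj_q.
Qed.

Definition in_row_span {v : nat} {T : finType} (g : 'I_v -> T)
    (M : T -> T -> bool) (F : T -> bool) : bool :=
  (\row_j F (g j) <= (\matrix_(i, j) M (g i) (g j) : 'M[bool]_v))%MS.

Section RowSpan.
Context {v : nat} {T : finType} (g : 'I_v -> T) (bij_g : bijective g).
Implicit Types (M N : T -> T -> bool) (F : T -> bool).
Notation span := (in_row_span g).

Lemma row_in_span M u : span M (M u).
Proof.
have [g' gK g'K] := bij_g; rewrite /in_row_span.
set A : 'M[bool]_v := \matrix_(i, j) M (g i) (g j).
have -> : (\row_j M u (g j) = row (g' u) A).
  by apply/rowP=> j; rewrite !mxE g'K.
exact: row_sub.
Qed.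

Lemma in_row_span_addb M F1 F2 :
  span M F1 -> span M F2 -> span M (fun x => F1 x (+) F2 x).
Proof.
rewrite /in_row_span => s1 s2; set A : 'M[bool]_v := \matrix_(i, j) M (g i) (g j).
have -> : (\row_j (F1 (g j) (+) F2 (g j))
    = (\row_j F1 (g j) + \row_j F2 (g j) : 'rV[bool]_v)).
  by apply/rowP=> j; rewrite !mxE.
exact: addmx_sub.
Qed.

Lemma eq_in_row_span M F1 F2 : F1 =1 F2 -> span M F1 -> span M F2.
Proof.
rewrite /in_row_span => e; set A : 'M[bool]_v := \matrix_(i, j) M (g i) (g j).
by have -> : (\row_j F1 (g j) = \row_j F2 (g j)) by apply/rowP=> j; rewrite !mxE e.
Qed.

Lemma leq_bool_rank (M : T -> T -> bool) (N : 'I_v -> T -> bool) :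
  (forall i, span M (N i)) ->
  (bool_rank (fun i j => N i (g j)) <= bool_rank (fun i j => M (g i) (g j)))%N.
Proof.
move=> sNM; apply: mxrankS; apply/row_subP => i.
have := sNM i; rewrite /in_row_span.
set A : 'M[bool]_v := \matrix_(i, j) M (g i) (g j).
by have -> : (\row_j N i (g j) = row i (\matrix_(i, j) N i (g j)))
  by apply/rowP=> j; rewrite !mxE.
Qed.

(* A second difference when [w, x, y, z] is a parallelogram: it then reads off one
   quadratic coefficient of [F]. *)
Definition alternation (F : T -> bool) (w x y z : T) : bool :=
  F w (+) F x (+) F y (+) F z.

(** [alternation] is linear in [F], so its vanishing on the rows passes to their combinations. *)
Lemma alternation_in_row_span M F w x y z :
  (forall u, alternation (M u) w x y z = false) -> span M F ->
  alternation F w x y z = false.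
Proof.
have [g' gK g'K] := bij_g.
move=> M0 /submxP[D defF].
have FE t : F t = (\sum_i D ord0 i * M (g i) t) :> bool.
  have /rowP/(_ (g' t)) := defF; rewrite !mxE g'K => ->.
  by apply: eq_bigr => i _; rewrite !mxE g'K.
have -> : alternation F w x y z = (F w + F x + F y + F z) by [].
rewrite !FE -!big_split /= big1 // => i _.
by rewrite -!mulrDr (_ : _ + _ = 0) ?mulr0 //; exact: M0.
Qed.

(** The row space of [M] lies in that of [N], strictly so because the linear functional
    [alternation] kills every row of [M] but not row [u] of [N]. *)
Lemma ltn_bool_rank M N w x y z u :
  (forall t, span N (M t)) -> (forall t, alternation (M t) w x y z = false) ->
  alternation (N u) w x y z ->
  (bool_rank (fun i j => M (g i) (g j)) < bool_rank (fun i j => N (g i) (g j)))%N.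
Proof.
move=> sMN M0; apply: contraTT; rewrite -leqNgt => leNM.
suff sNM : span M (N u) by rewrite (alternation_in_row_span _ _ _ _ _ _ M0 sNM).
have leMN : ((\matrix_(i, j) M (g i) (g j) : 'M[bool]_v)
             <= (\matrix_(i, j) N (g i) (g j) : 'M[bool]_v))%MS.
  apply/row_subP => i; have := sMN (g i); rewrite /in_row_span.
  set A : 'M[bool]_v := \matrix_(i, j) N (g i) (g j) => h.
  by rewrite (_ : row i _ = \row_j M (g i) (g j)) //; apply/rowP=> j; rewrite !mxE.
rewrite /in_row_span (submx_trans _
  (_ : (\matrix_(i, j) N (g i) (g j) : 'M[bool]_v) <= _)%MS) //.
  exact: row_in_span.
by rewrite -(geq_leqif (mxrank_leqif_sup leMN)).
Qed.

End RowSpan.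

End BoolRank.

(** * The twisted functions *)

Definition twist_shift {W : Type} (t : bool -> bool -> bool * bool) (e : bool)
    (j : bool * bool * W) : bool * bool * W :=
  let: (c, d, w) := j in
  if e then (c (+) (t c d).1, d (+) (t c d).2, w) else j.

(** A translate of the quadratic form [x_3 x_4], added orthogonally to [M]. *)
Definition hyperbolic {S T : Type} (M : S -> T -> bool)
    (j : bool * bool * S) (z : bool * bool * T) : bool :=
  ((z.1.1 (+) j.1.1) && (z.1.2 (+) j.1.2)) (+) M j.2 z.2.

Definition twisted {S T : Type} (M : S -> T -> bool)
    (t : bool -> bool -> bool * bool) (i : bool * bool * (bool * bool * S))
    (x : bool * bool * (bool * bool * T)) : bool :=
  ((x.1.1 (+) i.1.1) && (x.1.2 (+) i.1.2))
  (+) hyperbolic M (twist_shift t (i.1.2 && x.1.2) i.2) x.2.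

Definition twist0 (c d : bool) : bool * bool := (false, false).
Definition twist1 (c d : bool) : bool * bool := (d, false).
Definition twist2 (c d : bool) : bool * bool := (d, c (+) d).

Lemma twist_shift_inj {W : Type} t e :
  injective (fun u : bool * bool =>
    (u.1 (+) (t u.1 u.2).1, u.2 (+) (t u.1 u.2).2)) ->
  injective (@twist_shift W t e).
Proof.
move=> inj_t [[c d] w] [[c' d'] w']; case: e => // -[ec ed ->].
by have /= [-> ->] := inj_t (c, d) (c', d') (congr2 pair ec ed).
Qed.

(** Adding the twist sends [(c, d)] to [(c (+) d, d)], and for [twist2] to [(c (+) d, c)]; both are
    permutations. *)
Lemma twist1_inj {W : Type} e : injective (@twist_shift W twist1 e).
Proof. by apply: twist_shift_inj => -[[] []] [[] []]. Qed.

Lemma twist2_inj {W : Type} e : injective (@twist_shift W twist2 e).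
Proof. by apply: twist_shift_inj => -[[] []] [[] []]. Qed.

Lemma regular_hadamard_hyperbolic {S T : finType} (r : nat) (M : S -> T -> bool) :
  regular_hadamard r M -> regular_hadamard (2 * r) (hyperbolic M).
Proof.
move=> hM.
have := regular_hadamard_step r M false false
  (fun _ _ => id) (fun _ _ => @inj_id S) hM.
by apply: eq_regular_hadamard => i x; rewrite /hyperbolic !addbF.
Qed.

(** The twist permutes the rows of the inner matrix in a way that depends only on [(a, y)], as the
    doubling step allows. *)
Lemma regular_hadamard_twisted {S T : finType} (r : nat) (M : S -> T -> bool) t :
  (forall e, injective (@twist_shift S t e)) ->
  regular_hadamard r M -> regular_hadamard (2 * (2 * r)) (twisted M t).
Proof.
move=> inj_t /regular_hadamard_hyperbolic hM.
have := regular_hadamard_step _ _ false false (fun a y => twist_shift t (a && y))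
  (fun a y => inj_t _) hM.
by apply: eq_regular_hadamard => i x; rewrite /twisted !addbF.
Qed.

Lemma mulbE (x y : bool) : (x * y)%g = x (+) y.
Proof. by []. Qed.

(** * Translates and row spaces of the twisted functions *)

Section TwistedRows.
Context {W : finGroupType} (mulC : commutative (@mulg W)) (q : W -> bool).
Notation M := (fun u w : W => q (w * u)%g).
Notation G := (bool * bool * (bool * bool * W))%type.

(** Each [f_i] is bent: in [f_i (g * h)] the twist depends only on the sum of the second coordinates
    of [g] and [h], and once these are fixed it translates the inner row index, again a
    permutation. *)
Lemma twisted_translate_hadamard (r : nat) t (i : G) :
  regular_hadamard r M ->
  regular_hadamard (2 * (2 * r)) (fun g h : G => twisted M t i (g * h)%g).
Proof.
case: i => [[b a] j] hM.
pose s y := twist_shift t (a && y) j.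
have hH := regular_hadamard_hyperbolic _ _ hM.
have := regular_hadamard_step _ _ a b
  (fun a' y (k : bool * bool * W) => k * s (y (+) a'))%g
  (fun a' y => mulIg _) hH.
apply: eq_regular_hadamard => -[[xi eta] k] [[x y] z] /=.
rewrite /twisted /= !mulbE -/(s _) (addbC xi) (addbC eta); congr (_ (+) _).
case: z k => [[x2 y2] w] [[xi2 eta2] zeta].
case: (s _) => [[c d] om].
rewrite /hyperbolic /= !mulbE -!addbA (addbCA x2) (addbCA y2).
by rewrite [in RHS](mulC zeta) mulgA.
Qed.

(** Index [1] has [a = 0], which switches the twist off. This accounts for the slices of rank
    [r_0]. *)
Lemma twisted1_mul t g h : twisted M t 1%g (g * h)%g = twisted M twist0 g h.
Proof.
case: g h => [[b a] [[c d] u]] [[x y] [[x2 y2] w]].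
rewrite /twisted /hyperbolic /= !mulbE !addbF mulg1 (mulC u) (addbC b) (addbC a).
by rewrite (addbC c) (addbC d) if_same.
Qed.

Context {v : nat} (g : 'I_v -> G) (bij_g : bijective g).
Notation span := (in_row_span g).
Notation "F +1 H" := (fun x => F x (+) H x) (at level 50, left associativity).

(** Here [x], [y], [x2], [y2] are the coordinates [x_1], [x_2], [x_3], [x_4], and [om] is [u]. *)
Lemma twistedE t b a c d om x y x2 y2 w :
  twisted M t (b, a, (c, d, om)) (x, y, (x2, y2, w)) =
    (x (+) b) && (y (+) a)
    (+) ((x2 (+) (c (+) (a && y && (t c d).1)))
         && (y2 (+) (d (+) (a && y && (t c d).2)))
    (+) q (w * om)%g).
Proof.
by rewrite /twisted /hyperbolic /twist_shift /=; case: (a && y); rewrite ?addbF.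
Qed.

Lemma in_row_span_andb (N : G -> G -> bool) (e : bool) F :
  span N F -> span N (fun x => e && F x).
Proof.
case: e => // sF; apply: eq_in_row_span (in_row_span_addb _ _ _ _ sF sF) => x.
exact: addbb.
Qed.

(* The directions [(0, a, (0, 0, 1))] and [(0, 0, (c, d, 1))] are orthogonal for the
   polar form, so the alternating sum over a parallelogram they span vanishes. *)
Lemma twist0_in_row_span t u :
  t false false = (false, false) -> span (twisted M t) (twisted M twist0 u).
Proof.
move=> t0; case: u => [[b a] [[c d] om]].
pose f i := twisted M t i.
(* Each of these three rows has [a = 0] or [c = d = 0], so the twist leaves it alone. *)
apply: (@eq_in_row_span _ _ _ _ (f (b, a, (false, false, om)) +1
  f (b, false, (c, d, om)) +1 f (b, false, (false, false, om)))); last first.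
  by do ![exact: row_in_span | apply: in_row_span_addb].
move=> [[x y] [[x2 y2] w]]; rewrite /f !twistedE /= t0 /=.
case: (q _); move: b a c d x y x2 y2; do 8!case; reflexivity.
Qed.

(** For [a = 1], both twists agree at [(0, 0)] and [(1, 1)], and [twist1] vanishes at [(1, 0)]; only
    [(0, 1)] needs a combination. *)
Lemma twist1_in_row_span u : span (twisted M twist2) (twisted M twist1 u).
Proof.
case: u => [[b a] [[c d] om]].
have s2 i : span (twisted M twist2) (twisted M twist2 i) by exact: row_in_span.
have s0 i : span (twisted M twist2) (twisted M twist0 i).
  exact: twist0_in_row_span.
case: a; last by apply: eq_in_row_span (s2 (b, false, (c, d, om))) => -[].
case: c; case: d.
- apply: eq_in_row_span (s2 (b, true, (true, true, om))).
  by move=> [[x y] [[x2 y2] w]]; rewrite !twistedE /=; case: y.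
- apply: eq_in_row_span (s0 (b, true, (true, false, om))).
  by move=> [[x y] [[x2 y2] w]]; rewrite !twistedE /=; case: y.
(* For [d = 1] the twist [(1, 0)] adds [y && ~~ y2] whatever [c] is, so the difference taken at
   [(true, true)] serves here too. *)
- apply: (@eq_in_row_span _ _ _ _ (twisted M twist2 (b, true, (true, true, om)) +1
    twisted M twist0 (b, true, (false, true, om)) +1
    twisted M twist0 (b, true, (true, true, om)))); last first.
    by do ![exact: s2 | exact: s0 | apply: in_row_span_addb].
  move=> [[x y] [[x2 y2] w]]; rewrite !twistedE /=.
  by case: (q _); case: y; move: b x x2 y2; do 4![case].
- apply: eq_in_row_span (s2 (b, true, (false, false, om))).
  by move=> [[x y] [[x2 y2] w]]; rewrite !twistedE /=; case: y.
Qed.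

Lemma twist1_translate_in_row_span i h :
  span (twisted M twist1) (fun x => twisted M twist1 i (x * h)%g).
Proof.
case: i h => [[b a] [[c d] om]] [[xi eta] [[xi2 eta2] zeta]].
have s1 u : span (twisted M twist1) (twisted M twist1 u) by exact: row_in_span.
have s0 u : span (twisted M twist1) (twisted M twist0 u).
  exact: twist0_in_row_span.
(* Unless [a = d = 1], the row is untwisted, and its translate is another untwisted row. *)
have [/andP[-> ->]|nad] := boolP (a && d); last first.
  apply: eq_in_row_span
    (s0 (b (+) xi, a (+) eta, (c (+) xi2, d (+) eta2, zeta * om)%g)).
  move=> [[x y] [[x2 y2] w]]; rewrite /= !twistedE /= mulgA.
  rewrite !mulbE -!addbA (addbC b) (addbC a) (addbCA xi2) (addbCA eta2).
  by rewrite (andbAC a) (negPf nad) !andbF !addbF.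
set b' := b (+) xi; set c' := c (+) xi2 (+) eta; set om' := (zeta * om)%g.
pose f0 u := twisted M twist0 u.
(* Beyond passing to [b'], [c'], [om'], translation adds [eta (x + b')] and [eta2 (x2 + c' + y)].
   These affine functions are the sums of untwisted rows below. *)
apply: (@eq_in_row_span _ _ _ _ (twisted M twist1 (b', true, (c', true, om'))
  +1 (fun x => eta && (f0 (b', true, (false, false, om')) x
                       (+) f0 (b', false, (false, false, om')) x))
  +1 (fun x => eta2 && (f0 (false, false, (c', false, om')) x
                       (+) f0 (false, false, (c', true, om')) x
                       (+) f0 (true, false, (false, false, om')) x
                       (+) f0 (false, false, (false, false, om')) x)))); last first.
  by do ![exact: s0 | exact: s1 | apply: in_row_span_andb | apply: in_row_span_addb].
move=> [[x y] [[x2 y2] w]]; rewrite /f0 /= !twistedE /b' /c' /om' /= mulgA {b' c' om' f0}.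
case: (q _); move: b c x y x2 y2 xi eta xi2 eta2.
all: do 10!case; reflexivity.
Qed.

Notation rank t := (bool_rank (fun i j => twisted M t (g i) (g j))).

Lemma twist_ranks : rank twist0 < rank twist1 < rank twist2.
Proof.
pose p (y x2 y2 : bool) : G := (false, y, (x2, y2, 1%g)).
(* Index [u] has [a = d = 1] and [c = 0], where [twist1] is [(1, 0)] and [twist2] is [(1, 1)]. *)
pose u : G := p true false true.
apply/andP; split.
(* Varying [y] and [y2] reads off the coefficient of [x_2 x_4]. *)
- apply: (ltn_bool_rank g bij_g (twisted M twist0) (twisted M twist1)
     (p false false false) (p true false false)
    (p false false true) (p true false true) u).
  + by move=> i; apply: twist0_in_row_span.
  + move=> [[b a] [[c d] om]]; rewrite /alternation !twistedE /=.
    case: (q _); move: b a c d; do 4!case; reflexivity.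
  + by rewrite /alternation !twistedE /=; case: (q _).
(* Varying [y] and [x2] reads off the coefficient of [x_2 x_3]. *)
- apply: (ltn_bool_rank g bij_g (twisted M twist1) (twisted M twist2)
     (p false false false) (p true false false)
    (p false true false) (p true true false) u).
  + exact: twist1_in_row_span.
  + move=> [[b a] [[c d] om]]; rewrite /alternation !twistedE /=.
    case: (q _); move: b a c d; do 4!case; reflexivity.
  + by rewrite /alternation !twistedE /=; case: (q _).
Qed.

End TwistedRows.

(** The orthogonal sum of [r] hyperbolic planes, built up from the zero function on the trivial
    group. *)
Lemma bent_group_exists (r : nat) :
  exists (W : finGroupType) (q : W -> bool), commutative (@mulg W) /\
    regular_hadamard (2 ^ r) (fun u w : W => q (w * u)%g).
Proof.
elim: r => [|r [W [q [mulC hq]]]].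
  exists 'I_1, xpred0; split; first by move=> x y; rewrite !ord1.
  split; first by rewrite card_ord.
  - by move=> i; rewrite big_ord1.
  - by move=> i; rewrite big_ord1.
  - by move=> i j; rewrite big_ord1 !ord1.
  - by move=> i j; rewrite big_ord1 !ord1.
exists (bool * bool * W)%type, (fun x => (x.1.1 && x.1.2) (+) q x.2); split.
  by move=> [[a b] x] [[c d] y]; congr (_, _, _); rewrite ?addbC //; apply: addbC.
rewrite expnS; apply: eq_regular_hadamard (regular_hadamard_hyperbolic _ _ hq).
by [].
Qed.

(** * Slice ranks as paratopy invariants *)

Lemma prod_update {G : finGroupType} {I : eqType} (s : seq I) (x : I) (F : I -> G) :
  uniq s -> x \in s ->
  exists a b, forall h,
    (\prod_(t <- s) (if t == x then h else F t) = a * h * b)%g.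
Proof.
move=> uniq_s /splitPr def_s; case: def_s uniq_s => s1 s2.
rewrite cat_uniq /= negb_or -andbA => /and5P[_ x_s1 _ x_s2 _].
exists (\prod_(t <- s1) F t)%g, (\prod_(t <- s2) F t)%g => h.
have eqF s3 : x \notin s3 ->
    (\prod_(t <- s3) (if t == x then h else F t) = \prod_(t <- s3) F t)%g.
  move=> x_s3; apply: eq_big_seq => t t_s3; rewrite ifN //.
  by apply: contraNneq x_s3 => <-.
by rewrite big_cat big_cons /= eqxx !eqF // mulgA.
Qed.

(** The two forms record whether [x] precedes [y] in [s], since [G] may be non-commutative. *)
Lemma prod_update2 {G : finGroupType} {I : eqType} (s : seq I) (x y : I)
    (F : I -> G) :
  uniq s -> x \in s -> y \in s -> x != y ->
  exists a b c,
    (forall h k, (\prod_(t <- s) (if t == x then h else if t == y then k else F t)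
                  = a * h * b * k * c)%g) \/
    (forall h k, (\prod_(t <- s) (if t == x then h else if t == y then k else F t)
                  = a * k * b * h * c)%g).
Proof.
move=> uniq_s /splitPr def_s; case: def_s uniq_s => s1 s2.
rewrite cat_uniq /= negb_or -andbA => /and5P[u1 x_s1 disj x_s2 u2].
rewrite mem_cat inE => y_s ne_xy.
rewrite (negPf (_ : y != x)) in y_s; last by rewrite eq_sym.
have updF s3 k h : x \notin s3 ->
    (\prod_(t <- s3) (if t == x then h else if t == y then k else F t)
     = \prod_(t <- s3) if t == y then k else F t)%g.
  move=> x_s3; apply: eq_big_seq => t t_s3; rewrite ifN //.
  by apply: contraNneq x_s3 => <-.
have constF s3 k : y \notin s3 ->
    (\prod_(t <- s3) (if t == y then k else F t) = \prod_(t <- s3) F t)%g.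
  move=> y_s3; apply: eq_big_seq => t t_s3; rewrite ifN //.
  by apply: contraNneq y_s3 => <-.
case/orP: y_s => [y_s1|/= y_s2].
  have y_s2 : y \notin s2.
    by apply: contra disj => y_s2; apply/hasP; exists y.
  have [a [b eF]] := prod_update s1 y F u1 y_s1.
  exists a, b, (\prod_(t <- s2) F t)%g; right=> h k.
  by rewrite big_cat big_cons /= eqxx !updF // eF constF // !mulgA.
have y_s1 : y \notin s1.
  by apply: contra disj => y_s1; apply/hasP; exists y.
have [a [b eF]] := prod_update s2 y F u2 y_s2.
exists (\prod_(t <- s1) F t)%g, a, b; left=> h k.
by rewrite big_cat big_cons /= eqxx !updF // eF constF // !mulgA.
Qed.

Definition has_slice_rank (n v r : nat) : {set cube n v} :=
  [set C | [exists x, exists y, exists c,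
    (x != y) && (bool_rank (slice C x y c) == r)]].

Lemma has_slice_rankP (n v r : nat) (C : cube n v) :
  reflect (exists x y c, x != y /\ bool_rank (slice C x y c) = r)
    (C \in has_slice_rank n v r).
Proof.
rewrite inE; apply: (iffP existsP).
  move=> [x /existsP[y /existsP[c /andP[xy /eqP e]]]].
  by exists x, y, c.
move=> [x [y [c [xy e]]]]; exists x; apply/existsP; exists y; apply/existsP.
by exists c; rewrite xy e eqxx.
Qed.

Lemma isotopy_slice_rank (n v r : nat) (alpha : {ffun 'I_n -> 'S_v}) (C : cube n v) :
  C \in has_slice_rank n v r -> isotopy alpha C \in has_slice_rank n v r.
Proof.
move=> /has_slice_rankP[x [y [c [xy <-]]]]; apply/has_slice_rankP.
exists x, y, [ffun t => alpha t (c t)]; split=> //.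
rewrite -(bool_rank_bij (slice C x y c) _ _ (@perm_inj _ (alpha x)^-1%g)
  (@perm_inj _ (alpha y)^-1%g)).
apply: eq_bool_rank => i j; rewrite /slice /isotopy ffunE; congr (C _).
apply/ffunP => t; rewrite !ffunE; case: eqP => [->|_] //.
by case: eqP => [->|_] //; rewrite permK.
Qed.

Lemma conjugation_slice_rank (n v r : nat) (gamma : 'S_n) (C : cube n v) :
  C \in has_slice_rank n v r -> conjugation gamma C \in has_slice_rank n v r.
Proof.
move=> /has_slice_rankP[x [y [c [xy <-]]]]; apply/has_slice_rankP.
exists (gamma^-1 x)%g, (gamma^-1 y)%g, [ffun t => c (gamma t)].
rewrite (inj_eq perm_inj); split=> //.
apply: eq_bool_rank => i j; rewrite /slice /conjugation ffunE; congr (C _).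
by apply/ffunP => t; rewrite !ffunE !(inj_eq perm_inj) permKV.
Qed.

(** A setwise stabiliser is a group, so the generators suffice. *)
Lemma paratopy_slice_rank (n v r : nat) :
  paratopy_group n v \subset 'N(has_slice_rank n v r | 'P)%g.
Proof.
rewrite gen_subG; apply/subsetP => p /setUP[] /imsetP[u _ ->];
  rewrite !inE /=; apply/subsetP => C C_in; rewrite inE /= /aperm permE.
  exact: isotopy_slice_rank C_in.
exact: conjugation_slice_rank C_in.
Qed.

Lemma equivalent_slice_rank (n v r : nat) (C1 C2 : cube n v) :
  equivalent_cubes C1 C2 ->
  (C1 \in has_slice_rank n v r) = (C2 \in has_slice_rank n v r).
Proof.
move=> /orbitP[p p_in <-].
by rewrite (astabs_act _ (subsetP (paratopy_slice_rank n v r) p p_in)).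
Qed.

(** Up to translating row and column labels and transposing, every slice is the matrix of
    [g i * g j \in D]. *)
Lemma difference_cube_slice_rank (n v k lambda r s : nat) (C : cube n v) :
  difference_cube k lambda C ->
  C \in has_slice_rank n v r -> C \in has_slice_rank n v s -> r = s.
Proof.
move=> [G [g [D [bij_g _ CE]]]].
suff rankC x y c : x != y ->
    bool_rank (slice C x y c) = bool_rank (fun i j => (g i * g j)%g \in D).
  move=> /has_slice_rankP[x [y [c [xy <-]]]] /has_slice_rankP[x' [y' [c' [xy' <-]]]].
  by rewrite !rankC.
move=> xy; have inj_g := bij_inj bij_g.
have sliceE i j : slice C x y c i j =
    ((\prod_t if t == x then g i else if t == y then g j else g (c t))%g \in D).
  rewrite /slice CE; under eq_bigr => t _ do rewrite ffunE !(fun_if g).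
  by [].
have inj_a a b : injective (fun i => a * g i * b)%g.
  by move=> i j /mulIg/mulgI/inj_g.
have transport (p q : 'I_v -> G) : injective p -> injective q ->
    bool_rank (fun i j => (p i * q j)%g \in D) =
    bool_rank (fun i j => (g i * g j)%g \in D).
  move=> ip iq.
  by rewrite (bool_rank_transport g (fun h k : G => (h * k)%g \in D) p q bij_g).
have [a [b [d [e|e]]]] := prod_update2 (index_enum 'I_n) x y (fun t => g (c t))
  (index_enum_uniq _) (mem_index_enum _) (mem_index_enum _) xy.
  rewrite -(transport (fun i => a * g i * b) (fun j => 1 * g j * d))%g //.
  by apply: eq_bool_rank => i j; rewrite sliceE e mul1g !mulgA.
rewrite -(transport (fun i => a * g i * b) (fun j => 1 * g j * d))%g // -bool_rank_tr.
by apply: eq_bool_rank => i j; rewrite sliceE e mul1g !mulgA.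
Qed.

(** * Group cubes over a commutative group *)

Section GroupCube.
Context {G : finGroupType} (mulC : commutative (@mulg G)).
Context {n v : nat} (g : 'I_v -> G).

Definition cube_of (f : G -> G -> bool) : cube n.+1 v :=
  [ffun i : {ffun 'I_n.+1 -> 'I_v} =>
    f (g (i ord0)) (\prod_(t < n.+1 | 0 < t) g (i t))%g].

(** By commutativity the fixed factors gather into one [w]. The first position indexes rows, indexes
    columns, or is fixed. *)
Lemma cube_of_slice (x y : 'I_n.+1) c : x != y ->
  exists w : G,
    [/\ x = ord0 -> forall f i j, slice (cube_of f) x y c i j = f (g i) (g j * w)%g,
        y = ord0 -> forall f i j, slice (cube_of f) x y c i j = f (g j) (g i * w)%g
      & x != ord0 -> y != ord0 -> forall f i j,
          slice (cube_of f) x y c i j = f (g (c ord0)) (g i * (g j * w))%g].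
Proof.
move=> xy; pose s := [seq t : 'I_n.+1 <- index_enum 'I_n.+1 | 0 < t].
have us : uniq s by rewrite filter_uniq ?index_enum_uniq.
have mem_s t : (t \in s) = (t != ord0).
  by rewrite mem_filter mem_index_enum andbT lt0n.
pose F t := g (c t).
pose P h k := (\prod_(t <- s) if t == x then h else if t == y then k else F t)%g.
have sliceE f i j : slice (cube_of f) x y c i j =
    f (if x == ord0 then g i else if y == ord0 then g j else F ord0) (P (g i) (g j)).
  rewrite /slice ffunE; congr f.
    by rewrite ffunE eq_sym; case: ifP => // _; rewrite eq_sym; case: ifP.
  rewrite /P big_filter; apply: eq_bigr => t _; rewrite ffunE.
  by case: ifP => // _; case: ifP.
case: (eqVneq x ord0) xy => [x0|x0] xy.
  have y0 : y != ord0 by rewrite eq_sym -x0.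
  have y_s : y \in s by rewrite mem_s.
  have [a [b e]] := prod_update s y F us y_s.
  exists (a * b)%g; split=> [_ f i j|/eqP yE|/eqP[]//]; last by rewrite yE in y0.
  rewrite sliceE x0 eqxx; congr f.
  rewrite /P mulgA (mulC (g j)) -e; apply: eq_big_seq => t; rewrite mem_s => t0.
  by rewrite x0 (negPf t0).
have x_s : x \in s by rewrite mem_s.
case: (eqVneq y ord0) xy => [y0|y0] xy.
  have [a [b e]] := prod_update s x F us x_s.
  exists (a * b)%g; split=> [/eqP xE|_ f i j|_ /eqP[]//]; first by rewrite xE in x0.
  rewrite sliceE (negPf x0) y0 eqxx; congr f.
  rewrite /P mulgA (mulC (g i)) -e; apply: eq_big_seq => t; rewrite mem_s => t0.
  by rewrite y0 (negPf t0).
have y_s : y \in s by rewrite mem_s.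
have [a [b [d e]]] := prod_update2 s x y F us x_s y_s xy.
exists (a * b * d)%g; split=> [/eqP xE|/eqP yE|_ _ f i j].
- by rewrite xE in x0.
- by rewrite yE in y0.
rewrite sliceE (negPf x0) (negPf y0).
have prodC h k : (a * h * b * k * d = h * (k * (a * b * d)))%g.
  by rewrite (mulC a) -!mulgA; congr mulg; rewrite [RHS]mulC (mulC k) !mulgA.
by congr f; rewrite /P; case: e => ->; rewrite prodC // !mulgA (mulC (g j)).
Qed.

Context (bij_g : bijective g).
Let inj_g := bij_inj bij_g.

Lemma bij_mul_right (w : G) : bijective (fun j => g j * w)%g.
Proof. exact: (bij_comp (Bijective (mulgK w) (mulgKV w)) bij_g). Qed.

Lemma cube_of_design_cube (m : nat) (f : G -> G -> bool) :
  0 < m -> regular_hadamard (2 ^ m) f ->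
  (forall u, regular_hadamard (2 ^ m) (fun h k => f u (h * k)%g)) ->
  design_cube (2 ^ (m - 1) * (2 ^ m - 1))
    (2 ^ (m - 1) * (2 ^ (m - 1) - 1)) (cube_of f).
Proof.
move=> m_gt0 hf hft x y c xy; have [w [ex ey exy]] := cube_of_slice x y c xy.
have bij_w := bij_mul_right w.
case: (eqVneq x ord0) => [x0|x0].
  exact: (regular_hadamard_incidence v m f g (fun j => g j * w)%g _ m_gt0 hf
    bij_g bij_w (ex x0 f)).
case: (eqVneq y ord0) => [y0|y0].
  exact: (regular_hadamard_incidence v m _ (fun i => g i * w)%g g _ m_gt0
    (regular_hadamard_tr _ _ hf) bij_w bij_g (ey y0 f)).
exact: (regular_hadamard_incidence v m _ g (fun j => g j * w)%g _ m_gt0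
  (hft _) bij_g bij_w (exy x0 y0 f)).
Qed.

Lemma cube_of_group_cube (m : nat) (f : G -> G -> bool) :
  0 < m -> regular_hadamard (2 ^ m) f ->
  (forall u, regular_hadamard (2 ^ m) (fun h k => f u (h * k)%g)) ->
  group_cube (2 ^ (m - 1) * (2 ^ m - 1))
    (2 ^ (m - 1) * (2 ^ (m - 1) - 1)) (cube_of f).
Proof.
move=> m_gt0 hf hft.
exists G, g, (fun j => [set h | f (g j) h]), ord0; split=> //.
- exact: (regular_hadamard_design v m (fun h u => f u h) g g m_gt0
    (regular_hadamard_tr _ _ hf) bij_g bij_g).
- by move=> j; apply: (regular_hadamard_difference_set v m _ g).
- by move=> i; rewrite ffunE inE.
Qed.

Lemma bool_rank_translate (f : G -> G -> bool) (w : G) :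
  bool_rank (fun i j => f (g i) (g j * w)%g) = bool_rank (fun i j => f (g i) (g j)).
Proof.
exact: (bool_rank_transport g f g (fun j => g j * w)%g bij_g inj_g
  (bij_inj (bij_mul_right w))).
Qed.
End GroupCube.

Arguments cube_of {G} n {v} g f.

Lemma mul_pairC {A B : finGroupType} :
  commutative (@mulg A) -> commutative (@mulg B) ->
  commutative (@mulg (A * B)%type).
Proof.
by move=> mulA mulB [a b] [c d]; exact: (congr2 pair (mulA a c) (mulB b d)).
Qed.

(** * The cubes of the twisted functions *)

Section TwistedCube.
Context {W : finGroupType} (mulC : commutative (@mulg W)) (q : W -> bool).
Notation G := (bool * bool * (bool * bool * W))%type.
Context {n v : nat} (g : 'I_v -> G) (bij_g : bijective g).
Notation f := (twisted (fun u w : W => q (w * u)%g)).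
Notation rank t := (bool_rank (fun i j => f t (g i) (g j))).
Notation cube_t t := (cube_of n.+2 g (f t)).

Lemma mul_quadrantC : commutative (@mulg G).
Proof.
have boolC : commutative (@mulg bool) by exact: addbC.
exact: mul_pairC (mul_pairC boolC boolC) (mul_pairC (mul_pairC boolC boolC) mulC).
Qed.

Lemma twisted_cube_rank t : cube_t t \in has_slice_rank n.+3 v (rank t).
Proof.
have [g' gK g'K] := bij_g; apply/has_slice_rankP.
pose c : {ffun 'I_n.+3 -> 'I_v} := [ffun=> g' 1%g].
exists ord0, (Ordinal (isT : 1 < n.+3)), c; split=> //.
have [w [ex _ _]] := cube_of_slice mul_quadrantC g ord0
  (Ordinal (isT : 1 < n.+3)) c isT.
by rewrite -(bool_rank_translate g bij_g _ w); apply: eq_bool_rank; apply: ex.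
Qed.

Lemma twisted_cube_rank0 t : cube_t t \in has_slice_rank n.+3 v (rank twist0).
Proof.
have [g' gK g'K] := bij_g; apply/has_slice_rankP.
(* This fixes the first coordinate at index [1], whose function is untwisted. *)
pose c : {ffun 'I_n.+3 -> 'I_v} := [ffun=> g' 1%g].
pose x : 'I_n.+3 := Ordinal (isT : 1 < n.+3).
pose y : 'I_n.+3 := Ordinal (isT : 2 < n.+3).
exists x, y, c; split=> //.
have [w [_ _ exy]] := cube_of_slice mul_quadrantC g x y c isT.
rewrite -(bool_rank_translate g bij_g _ w); apply: eq_bool_rank => i j.
by rewrite exy // ffunE g'K; apply: twisted1_mul.
Qed.

(** Slices along the first position have rank exactly [r_1]; the rows of any other slice, up to
    transposition, are translates of one [f_i] and stay in the row space. *)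
Lemma twisted_cube_rank_le r :
  cube_t twist1 \in has_slice_rank n.+3 v r -> r <= rank twist1.
Proof.
move=> /has_slice_rankP[x [y [c [xy <-]]]].
have [w [ex ey exy]] := cube_of_slice mul_quadrantC g x y c xy.
case: (eqVneq x ord0) => [x0|x0].
  by rewrite -(bool_rank_translate g bij_g _ w) (eq_bool_rank _ _ (ex x0 _)).
case: (eqVneq y ord0) => [y0|y0].
  rewrite -(bool_rank_translate g bij_g _ w) (eq_bool_rank _ _ (ey y0 _)).
  by rewrite -bool_rank_tr.
rewrite (eq_bool_rank _ (fun i j => f twist1 (g (c ord0)) (g j * (g i * w))%g)).
  apply: (leq_bool_rank g (f twist1)
    (fun i h => f twist1 (g (c ord0)) (h * (g i * w))%g)) => i.
  exact: twist1_translate_in_row_span.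
by move=> i j; rewrite exy // mulgA (mul_quadrantC (g i)) -mulgA.
Qed.

Lemma twisted_cube_not_difference_cube t k lambda (C : cube n.+3 v) :
  rank twist0 != rank t -> difference_cube k lambda C ->
  ~ equivalent_cubes (cube_t t) C.
Proof.
move=> /eqP ne_rank dC eqC; apply: ne_rank.
by apply: (difference_cube_slice_rank _ _ _ _ _ _ _ dC);
  rewrite -(equivalent_slice_rank _ _ _ _ _ eqC) ?twisted_cube_rank0 ?twisted_cube_rank.
Qed.

Lemma twisted_cubes_inequivalent :
  rank twist1 < rank twist2 -> ~ equivalent_cubes (cube_t twist1) (cube_t twist2).
Proof.
rewrite ltnNge => /negP le_rank eqC; apply/le_rank/twisted_cube_rank_le.
by rewrite (equivalent_slice_rank _ _ _ _ _ eqC) twisted_cube_rank.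
Qed.

End TwistedCube.

Theorem theorem4p3 (m n : nat) (hm : 2 <= m) (hn : 3 <= n) :
  let v := 4 ^ m in
  let k := 2 ^ (m - 1) * (2 ^ m - 1) in
  let lambda := 2 ^ (m - 1) * (2 ^ (m - 1) - 1) in
  exists C1 C2 : cube n v,
    [/\ design_cube k lambda C1 /\ design_cube k lambda C2,
        group_cube k lambda C1 /\ group_cube k lambda C2,
        (forall C : cube n v,
           difference_cube k lambda C -> ~ equivalent_cubes C1 C),
        (forall C : cube n v,
           difference_cube k lambda C -> ~ equivalent_cubes C2 C)
      & ~ equivalent_cubes C1 C2].
Proof.
case: n hn => [|[|[|n]]] // _; move=> v k lambda.
have m_gt0 : 0 < m by apply: ltnW.
(* Two further hyperbolic planes each double the line sum, from [2 ^ (m - 2)] to [2 ^ m]. *)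
have [W [q [mulC hq]]] := bent_group_exists (m - 2).
have em : 2 * (2 * 2 ^ (m - 2)) = 2 ^ m by rewrite -!expnS; congr (2 ^ _); lia.
pose G := (bool * bool * (bool * bool * W))%type : finGroupType.
pose f t : G -> G -> bool := twisted (fun u w : W => q (w * u)%g) t.
have hf t : (forall e, injective (@twist_shift W t e)) ->
    regular_hadamard (2 ^ m) (f t).
  by move=> inj_t; rewrite -em; apply: regular_hadamard_twisted.
have hft t u : regular_hadamard (2 ^ m) (fun h k => f t u (h * k)%g).
  by rewrite -em; apply: twisted_translate_hadamard.
have cG : v = #|G|.
  by have [[-> _] _ _ _ _] := hf _ twist1_inj; rewrite -expnM mulnC expnM.
pose g (i : 'I_v) : G := enum_val (cast_ord cG i).
have bij_g : bijective g.
  exact: bij_comp (enum_val_bij G) (Bijective (cast_ordK cG) (cast_ordKV cG)).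
have mulGC : commutative (@mulg G) := mul_quadrantC mulC.
have /andP[lt01 lt12] := twist_ranks q g bij_g.
exists (cube_of n.+2 g (f twist1)), (cube_of n.+2 g (f twist2)).
have h1 := hf _ twist1_inj; have h2 := hf _ twist2_inj.
split.
- by split; apply: cube_of_design_cube.
- by split; apply: cube_of_group_cube.
- by move=> C; apply: twisted_cube_not_difference_cube; rewrite // neq_ltn lt01.
- move=> C; apply: twisted_cube_not_difference_cube; rewrite // neq_ltn.
  by rewrite (ltn_trans lt01 lt12).
- exact: twisted_cubes_inequivalent.
Qed.
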